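(* Let $|A|=n\ge 2$ and let $S=\{s_1,s_2\}$ with $1\le s_1<s_2\le k$ be a rank-set of size 2 in $A^*_{n,k}$. The $S_n$-representation on the homology of $A^*_{n,k}(S)$ is given by $$\bigoplus_{v=1}^{s_1}\left(c_v-\binom{s_1}{v}\right) S_{(n-1,1)}^{\otimes v}\ \oplus\ \bigoplus_{v=1+s_1}^{s_2} c_v\, S_{(n-1,1)}^{\otimes v},$$ where $c_v$ is the following positive integer: $$c_v=\sum_{j=1}^{\min(v,\,s_2-s_1)}\binom{s_2-j}{v-j}\binom{s_1+j-1}{j}.$$ Moreover $c_v\ge\binom{s_1}{v}$ when $v\le s_1$, and hence the homology is a nonnegative integer combination of positive tensor powers of $S_{(n-1,1)}$.
   Context: $A^*$ is the set of all finite words in the alphabet $A$, $|A|=n$, including the empty word, ordered by the subword order: $u\le v$ if $u$ is obtained from $v$ by deleting letters (not necessarily consecutive). The rank of a word is its length. For $S\subseteq[1,k]=\{1,\dots,k\}$, $A^*_{n,k}(S)$ is the subposet of words with length in $S$; its homology means the reduced simplicial homology, with complex coefficients, of its order complex (any attached bottom or top element is removed first), which here is concentrated in degree $|S|-1=1$. $S_n$ acts by permuting the letters of $A$. $S_{(n-1,1)}$ is the irreducible complex $S_n$-module indexed by $(n-1,1)$, and $b\,V$ denotes a direct sum of $b$ copies of $V$. *)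

(* Defs.v *)
From HB Require Import structures.
From mathcomp Require Import all_boot all_order all_fingroup all_algebra.
From mathcomp Require Import mxrepresentation character.
From mathcomp Require Import reals complex.

Set Implicit Arguments.
Unset Strict Implicit.
Unset Printing Implicit Defensive.

Import GroupScope Order.TTheory GRing.Theory.
Local Open Scope ring_scope.

(* As everywhere in MathComp, modules are spaces of row vectors on which groups
   act on the right; permutations compose accordingly, (s * t) x = t (s x), so
   the right action of s : {perm A} on letters, words and chains sends each
   letter a to s a. *)

Section PermutationModule.

Variables (F : fieldType) (gT : finGroupType) (T : finType).
Variables (to : {action gT &-> T}) (X : {set T}).

Definition perm_module_mx (g : gT) : 'M[F]_#|X| :=
  \matrix_(i, j) (to (enum_val i) g == enum_val j)%:R.

Hypothesis actX : [acts [set: gT], on X | to].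

Lemma perm_module_mul (g : gT) m (D : 'M[F]_(#|X|, m)) (i j : 'I_#|X|) l :
  to (enum_val i) g = enum_val j -> (perm_module_mx g *m D) i l = D j l.
Proof.
move=> ij; rewrite mxE (bigD1 j) //= mxE ij eqxx mul1r big1 ?addr0 // => k kj.
by rewrite mxE ij (inj_eq enum_val_inj) eq_sym (negbTE kj) mul0r.
Qed.

Lemma perm_module_imageP (g : gT) (i : 'I_#|X|) :
  {j : 'I_#|X| | to (enum_val i) g = enum_val j}.
Proof.
have Xi : to (enum_val i) g \in X.
  by rewrite (actsP actX) ?inE // enum_valP.
by exists (enum_rank_in Xi (to (enum_val i) g)); rewrite enum_rankK_in.
Qed.

Lemma perm_module_repr : mx_repr [set: gT] perm_module_mx.
Proof.
split=> [|g h _ _]; apply/matrixP=> i j.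
  by rewrite !mxE act1 (inj_eq enum_val_inj).
have [k ik] := perm_module_imageP g i.
by rewrite (perm_module_mul _ _ ik) !mxE actM ik.
Qed.

(* The module with basis X, whose elements are permuted by the group. *)
Definition perm_module : mx_representation F [set: gT] #|X| :=
  MxRepresentation perm_module_repr.

End PermutationModule.

Section TupleAction.

Variables (gT : finGroupType) (T : finType) (to : {action gT &-> T}) (p : nat).

Definition tuple_act (t : p.-tuple T) (g : gT) : p.-tuple T :=
  map_tuple (fun x => to x g) t.

Lemma tuple_act1 : tuple_act^~ 1%g =1 id.
Proof. by move=> t; apply: eq_from_tnth => i; rewrite tnth_map act1. Qed.

Lemma tuple_actM t g h : tuple_act t (g * h)%g = tuple_act (tuple_act t g) h.
Proof. by apply: eq_from_tnth => i; rewrite !tnth_map actM. Qed.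

Definition tuple_action : {action gT &-> p.-tuple T} :=
  TotalAction tuple_act1 tuple_actM.

End TupleAction.

Section OrderComplexHomology.

Variables (F : fieldType) (gT : finGroupType).
Variables (disp : Order.disp_t) (T : finPOrderType disp).
Variables (to : {action gT &-> T}) (X : {set T}).

(* The faces with p vertices of the order complex of the subposet X. *)
Definition chains p : {set p.-tuple T} :=
  [set t : p.-tuple T | sorted <%O t & all [in X] t].

Definition omit p (l : 'I_p.+1) (t : p.+1.-tuple T) : p.-tuple T :=
  [tuple tnth t (lift l i) | i < p].

(* The boundary map, x_0 < ... < x_p |-> \sum_l (-1)^l (x_l omitted); for
   p = 0 this is the augmentation. *)
Definition boundary p : 'M[F]_(#|chains p.+1|, #|chains p|) :=
  \matrix_(i, j)
    \sum_(l < p.+1 | omit l (enum_val i) == enum_val j) (-1) ^+ l.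

Hypothesis to_mono : forall g : gT, {homo to^~ g : x y / x <= y}%O.
Hypothesis actX : [acts [set: gT], on X | to].

Lemma chains_acts p : [acts [set: gT], on chains p | tuple_action to p].
Proof.
have to_lt g : {homo to^~ g : x y / x < y}%O.
  move=> x y; rewrite !lt_neqAle (inj_eq (act_inj to g)) => /andP[-> xy] /=.
  exact: to_mono.
have sub (g : gT) t : t \in chains p -> tuple_action to p t g \in chains p.
  rewrite !inE => /andP[st /allP Xt]; apply/andP; split.
    exact: homo_sorted (to_lt g) _ st.
  by apply/allP=> _ /mapP[x /Xt Xx ->]; rewrite /= (actsP actX) ?inE.
apply/actsP=> g _ t; apply/idP/idP; last exact: sub.
by move/(sub g^-1%g); rewrite -actM mulgV act1.
Qed.

Definition chain_module p :
    mx_representation F [set: gT] #|chains p| :=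
  perm_module F (chains_acts p).

Lemma omit_act p l (t : p.+1.-tuple T) (g : gT) :
  omit l (tuple_action to p.+1 t g) = tuple_action to p (omit l t) g.
Proof. by apply: eq_from_tnth => i; rewrite !(tnth_map, tnth_mktuple). Qed.

Lemma boundary_hom p (g : gT) :
  chain_module p.+1 g *m boundary p = boundary p *m chain_module p g.
Proof.
apply/matrixP=> i j.
have [i' ii'] := perm_module_imageP (chains_acts p.+1) g i.
have [j' jj'] := perm_module_imageP (chains_acts p) g^-1 j.
have j'j : tuple_action to p (enum_val j') g = enum_val j.
  by rewrite -jj' -actM mulVg act1.
rewrite (perm_module_mul _ _ ii') [RHS]mxE (bigD1 j') //= !mxE j'j eqxx mulr1.
rewrite [X in _ + X]big1 ?addr0 => [|k kj']; last first.
  rewrite [X in _ * X]mxE -j'j (inj_eq (act_inj _ g)) (inj_eq enum_val_inj).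
  by rewrite (negbTE kj') mulr0.
by apply: eq_bigl => l; rewrite -ii' omit_act -j'j (inj_eq (act_inj _ g)).
Qed.

Lemma cycles_module p : mxmodule (chain_module p.+1) (kermx (boundary p)).
Proof.
apply/mxmoduleP=> g _; apply/sub_kermxP.
by rewrite -mulmxA boundary_hom mulmxA mulmx_ker mul0mx.
Qed.

Lemma boundaries_module p : mxmodule (chain_module p) <<boundary p>>%MS.
Proof.
apply/mxmoduleP=> g _; rewrite !genmxE (eqmxMr _ (genmxE _)).
by rewrite -boundary_hom submxMl.
Qed.

(* A face of dimension d has d + 1 vertices. *)
Definition reduced_homology d :
    mx_representation F [set: gT] _ :=
  section_repr (boundaries_module d.+1) (cycles_module d).

End OrderComplexHomology.

Section Words.

Variables (A : finType) (k : nat).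

Definition word : Type := k.-bseq A.
HB.instance Definition _ := SubFinite.on word.

Fact subword_display : Order.disp_t. Proof. exact: Order.Disp tt tt. Qed.

Definition subword (u v : word) : bool := subseq u v.

Fact subword_refl : reflexive subword.
Proof. by move=> u; apply: subseq_refl. Qed.

Fact subword_anti : antisymmetric subword.
Proof. by move=> u v /subseq_anti /val_inj. Qed.

Fact subword_trans : transitive subword.
Proof. by move=> v u w; apply: subseq_trans. Qed.

HB.instance Definition _ := Order.Le_isPOrder.Build subword_display word
  subword_refl subword_anti subword_trans.

Definition word_act (w : word) (s : {perm A}) : word := [bseq of map s w].

Fact word_act1 : word_act^~ 1%g =1 id.
Proof.
by move=> w; apply: val_inj; rewrite /= (eq_map (@perm1 A)) map_id.
Qed.

Fact word_actM w s t : word_act w (s * t)%g = word_act (word_act w s) t.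
Proof.
by apply: val_inj; rewrite /= -map_comp; apply: eq_map => a; rewrite /= permM.
Qed.

Definition word_action : {action {perm A} &-> word} :=
  TotalAction word_act1 word_actM.

Fact word_action_mono (s : {perm A}) : {homo word_action^~ s : u v / u <= v}%O.
Proof. by move=> u v; apply: map_subseq. Qed.

Definition words_of_rank (S : {pred nat}) : {set word} :=
  [set w : word | size (w : k.-bseq A) \in S].

Fact words_of_rank_acts S :
  [acts [set: {perm A}], on words_of_rank S | word_action].
Proof. by apply/actsP=> s _ w; rewrite !inE size_map. Qed.

Definition word_homology (F : fieldType) (S : {pred nat}) (d : nat) :
    mx_representation F [set: {perm A}] _ :=
  reduced_homology F word_action_mono (words_of_rank_acts S) d.

End Words.

(* The Specht module of shape la over the alphabet A, i.e. the span of the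
   polytabloids in the permutation module on tabloids.  The shape la is meant
   to be a partition of #|A|, in nonincreasing order. *)
Section Specht.

Variables (F : fieldType) (A : finType) (la : seq nat).

(* A tabloid is recorded by the map giving the row of each letter. *)
Local Notation row_map := {ffun A -> 'I_(size la)}.
(* A filling gives the (row, column) position of each letter. *)
Local Notation filling := {ffun A -> 'I_(size la) * 'I_(head 0 la)}.

Definition ffun_act (Y : Type) (f : {ffun A -> Y}) (s : {perm A}) :
  {ffun A -> Y} := [ffun a => f (s^-1%g a)].

Fact ffun_act1 Y : (@ffun_act Y)^~ 1%g =1 id.
Proof. by move=> f; apply/ffunP=> a; rewrite ffunE invg1 perm1. Qed.

Fact ffun_actM Y f s t :
  @ffun_act Y f (s * t)%g = ffun_act (ffun_act f s) t.
Proof. by apply/ffunP=> a; rewrite !ffunE invMg permM. Qed.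

Definition ffun_action (Y : finType) : {action {perm A} &-> {ffun A -> Y}} :=
  TotalAction (@ffun_act1 Y) (@ffun_actM Y).

Definition tabloids : {set row_map} :=
  [set f : row_map | [forall r, #|[set a | f a == r]| == nth 0 la r]].

Fact tabloids_acts : [acts [set: {perm A}], on tabloids | ffun_action _].
Proof.
apply/actsP=> s _ f; rewrite !inE; apply: eq_forallb => r; congr (_ == _).
rewrite -[in RHS](card_imset _ (@perm_inj _ s)); apply: eq_card => a.
by rewrite -[a](permKV s) (mem_imset _ _ perm_inj) !inE ffunE permKV.
Qed.

Definition tableau (t : filling) : bool :=
  injectiveb t && [forall a, (t a).2 < nth 0 la (t a).1]%N.

Definition tabloid_of (t : filling) : row_map := [ffun a => (t a).1].

Definition column_stab (t : filling) : {set {perm A}} :=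
  [set s : {perm A} | [forall a, (t (s a)).2 == (t a).2]].

Definition polytabloid (t : filling) : 'rV[F]_#|tabloids| :=
  \row_j \sum_(s in column_stab t | ffun_act (tabloid_of t) s == enum_val j)
            (-1) ^+ s.

Definition specht_mx : 'M[F]_#|tabloids| :=
  (\sum_(t : filling | tableau t) <<polytabloid t>>)%MS.

Fact tableau_act (t : filling) g : tableau (ffun_act t g) = tableau t.
Proof.
wlog suff imp : t g / tableau t -> tableau (ffun_act t g).
  apply/idP/idP; last exact: imp.
  by move/(imp _ g^-1%g); rewrite -ffun_actM mulgV ffun_act1.
case/andP=> /injectiveP inj /forallP lt; apply/andP; split.
  by apply/injectiveP=> a b; rewrite !ffunE => /inj /perm_inj.
by apply/forallP=> a; rewrite ffunE.
Qed.

Fact polytabloid_act (t : filling) g :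
  polytabloid t *m perm_module F tabloids_acts g = polytabloid (ffun_act t g).
Proof.
apply/rowP=> j; rewrite !mxE.
have [j' jj'] := perm_module_imageP tabloids_acts g^-1 j.
have j'j : ffun_action _ (enum_val j') g = enum_val j.
  by rewrite -jj' -actM mulVg act1.
rewrite (bigD1 j') //= !mxE j'j eqxx mulr1.
rewrite [X in _ + X]big1 ?addr0 => [|i ij']; last first.
  rewrite [X in _ * X]mxE -j'j (inj_eq (act_inj _ g)) (inj_eq enum_val_inj).
  by rewrite (negbTE ij') mulr0.
rewrite [RHS](reindex_inj (@conjg_inj _ g)) /=; apply: eq_big => [s|s _].
  congr (_ && _).
    rewrite !inE; apply/forallP/forallP => H a.
      by rewrite -[a](permKV g) permJ !ffunE !permK.
    by have := H (g a); rewrite permJ !ffunE !permK.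
  have -> : ffun_act (tabloid_of (ffun_act t g)) (s ^ g)%g =
            ffun_action _ (ffun_act (tabloid_of t) s) g.
    by apply/ffunP=> a; rewrite !ffunE -conjVg -[a](permKV g) permJ !permK.
  by rewrite -j'j (inj_eq (act_inj _ g)).
by rewrite odd_permJ.
Qed.

Fact specht_module : mxmodule (perm_module F tabloids_acts) specht_mx.
Proof.
apply/mxmoduleP=> g _; rewrite /specht_mx sumsmxMr.
apply/sumsmx_subP=> t tabt; rewrite (eqmxMr _ (genmxE _)) polytabloid_act.
rewrite (sumsmx_sup (ffun_act t g)) ?tableau_act ?genmxE //.
Qed.

Definition specht : representation F [set: {perm A}] :=
  Representation (submod_repr specht_module).

End Specht.

Section TensorPower.

Variables (F : fieldType) (gT : finGroupType) (G : {group gT}).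

Fact trivial_mx_repr : mx_repr G (fun=> 1%:M : 'M[F]_1).
Proof. by split=> // g h _ _; rewrite mulmx1. Qed.

Definition tensor_grepr (V W : representation F G) :
    representation F G :=
  Representation (prod_repr V W).

Definition tensor_power (V : representation F G) (v : nat) :
    representation F G :=
  iterop v tensor_grepr V (Representation (MxRepresentation trivial_mx_repr)).

End TensorPower.

(* The subtractions never truncate when s1 < s2 and v <= s2. *)
Definition coef_c (s1 s2 v : nat) : nat :=
  (\sum_(1 <= j < (minn v (s2 - s1)).+1)
     'C(s2 - j, v - j) * 'C(s1 + j - 1, j))%N.

(* Main.v *)
(** In characteristic 0 two modules with equal traces are isomorphic: averaging
    over the group is an idempotent on Hom(V, W) whose trace only depends on the
    traces of V and W, so it is nonzero when they agree and V is not 0; a nonzero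
    homomorphism f then splits V as ker f plus a copy of im f, and W as im f
    plus D, and one proceeds by induction with ker f and D.

    If a permutation fixes x + 1 letters, then x is its trace on the module of
    shape (n-1, 1).  The graph of the words of lengths s1 and s2 is connected,
    since words differing in one letter have a common superword one letter
    longer; hence the trace on the homology is the number of fixed pairs u < w
    minus the number of fixed words, plus 1.  The number of superwords of u only
    depends on the length of u, and reading w from left to right gives it as a
    polynomial in x, from which the coefficients c_v are read off. *)

From HB Require Import structures.
Require Import Defs.
From mathcomp Require Import all_boot all_order all_fingroup all_algebra.
From mathcomp Require Import pgroup mxrepresentation character.
From mathcomp Require Import reals complex.
From mathcomp Require Import zify ring.

Set Implicit Arguments.
Unset Strict Implicit.
Unset Printing Implicit Defensive.

Import GroupScope Order.TTheory GRing.Theory.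
Local Open Scope ring_scope.

(** * Traces of idempotents and of endomorphisms of matrix spaces *)

(** Factor E as C R through its rank. Idempotence cancels to R C = 1, and C R and R C have the same
    trace. *)
Lemma mxtrace_idempotent (F : fieldType) n (E : 'M[F]_n) :
  E *m E = E -> \tr E = (\rank E)%:R.
Proof.
move=> idE; rewrite -{1}[E]mulmx_base mxtrace_mulC.
suff -> : row_base E *m col_base E = 1%:M by rewrite mxtrace1.
apply: (row_free_inj (row_base_free E)); rewrite /= mul1mx.
apply: (row_full_inj (col_base_full E)) => /=.
move: (col_base E) (row_base E) (mulmx_base E) => C R CR.
by rewrite !mulmxA CR -mulmxA CR idE.
Qed.

Lemma mxtrace_lin_mx (F : fieldType) m n (f : {linear 'M[F]_(m, n) -> 'M_(m, n)}) :
  \tr (lin_mx f) = \sum_i \sum_j f (delta_mx i j) i j.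
Proof.
rewrite /mxtrace pair_bigA /= (reindex _ (curry_mxvec_bij _ _)) /=.
apply: eq_bigr => -[i j] _ /=; set k := mxvec_index i j.
transitivity (row k (lin_mx f) 0 k); first by rewrite [RHS]mxE.
by rewrite rowE -mxvec_delta mul_vec_lin mxvecE.
Qed.

(** By [mxtrace_lin_mx] the left side is the trace of the map sending M to A M B. The (i, j)
    coefficient of A E_ij B is A_ii B_jj, so the sum factors. *)
Lemma sum_delta_mx_coef (F : fieldType) m n (A : 'M[F]_m) (B : 'M[F]_n) :
  \sum_i \sum_j (A *m delta_mx i j *m B) i j = \tr A * \tr B.
Proof.
rewrite /mxtrace mulr_suml; apply: eq_bigr => i _; rewrite mulr_sumr.
apply: eq_bigr => j _.
rewrite -(mul_delta_mx (0 : 'I_1)) mulmxA -mulmxA -colE -rowE.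
by rewrite mxE big_ord1 !mxE.
Qed.

Lemma pchar0_pgroup (F : fieldType) (gT : finGroupType) (G : {group gT}) :
  [pchar F] =i pred0 -> [pchar F]^'.-group G.
Proof.
move/pcharf0P=> char0.
by rewrite /pgroup pcharf'_nat char0 -lt0n cardG_gt0.
Qed.

(** * Averaging over the group *)

Section Averaging.

Variables (F : fieldType) (gT : finGroupType) (G : {group gT}) (n1 n2 : nat).
Variables (rG1 : mx_representation F G n1) (rG2 : mx_representation F G n2).

(** The Reynolds operator: when |G| is invertible in F, it projects all matrices onto the
    homomorphisms from [rG1] to [rG2]. *)
Definition average_mx (M : 'M[F]_(n1, n2)) : 'M_(n1, n2) :=
  #|G|%:R^-1 *: \sum_(x in G) rG1 x^-1%g *m M *m rG2 x.

Fact average_mx_is_linear : linear average_mx.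
Proof.
move=> a M N; rewrite /average_mx !scaler_sumr -big_split; apply: eq_bigr => x _.
by rewrite mulmxDr mulmxDl -scalemxAr -scalemxAl scalerDr !scalerA mulrC.
Qed.
HB.instance Definition _ :=
  GRing.isLinear.Build F 'M_(n1, n2) 'M_(n1, n2) _ average_mx
    average_mx_is_linear.

Lemma average_mx_hom M x : x \in G -> rG1 x *m average_mx M = average_mx M *m rG2 x.
Proof.
move=> Gx; rewrite -scalemxAr -scalemxAl; congr (_ *: _).
rewrite mulmx_sumr mulmx_suml (reindex_acts 'R _ Gx) ?astabsR //=.
apply: eq_bigr => y Gy.
rewrite invMg !repr_mxM ?groupV ?groupM // !mulmxA.
by rewrite -repr_mxM ?groupV // mulgV repr_mx1 mul1mx.
Qed.

Lemma average_mx_fix M : #|G|%:R != 0 :> F ->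
  {in G, forall x, rG1 x *m M = M *m rG2 x} -> average_mx M = M.
Proof.
move=> nzG homM; rewrite /average_mx (eq_bigr (fun=> M)) => [|x Gx].
  by rewrite sumr_const -scaler_nat scalerA mulVf ?scale1r.
by rewrite -mulmxA -homM // mulmxA -repr_mxM ?groupV // mulVg repr_mx1 mul1mx.
Qed.

Lemma mxtrace_average_mx :
  \tr (lin_mx average_mx) =
  #|G|%:R^-1 * \sum_(x in G) \tr (rG1 x^-1%g) * \tr (rG2 x).
Proof.
rewrite mxtrace_lin_mx; under [in RHS]eq_bigr do rewrite -sum_delta_mx_coef.
rewrite [in RHS]exchange_big mulr_sumr; apply: eq_bigr => i _.
rewrite exchange_big mulr_sumr; apply: eq_bigr => j _.
by rewrite !mxE summxE.
Qed.

End Averaging.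

(** * Kernels and images of homomorphisms *)

Section HomImage.

Variables (F : fieldType) (gT : finGroupType) (G : {group gT}) (n1 n2 : nat).
Variables (rG1 : mx_representation F G n1) (rG2 : mx_representation F G n2).
Variable f : 'M[F]_(n1, n2).
Hypothesis homf : {in G, forall x, rG1 x *m f = f *m rG2 x}.

Lemma hom_ker_module : mxmodule rG1 (kermx f).
Proof.
apply/mxmoduleP=> x Gx; apply/sub_kermxP.
by rewrite -mulmxA homf // mulmxA mulmx_ker mul0mx.
Qed.

Lemma hom_image_module : mxmodule rG2 <<f>>%MS.
Proof.
apply/mxmoduleP=> x Gx.
by rewrite genmxE (eqmxMr _ (genmxE f)) -homf // submxMl.
Qed.

(** The restriction of f to a complement C of its kernel is a bijection onto the image; the
    isomorphism is f written in the bases of C and [<<f>>]. *)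
Lemma hom_image_rsim (C : 'M_n1) (modC : mxmodule rG1 C)
    (modI : mxmodule rG2 <<f>>%MS) :
  (kermx f + C :=: 1%:M)%MS -> mxdirect (kermx f + C) ->
  mx_rsim (submod_repr modC) (submod_repr modI).
Proof.
move=> defC /mxdirect_addsP tiKC.
have imC : (C *m f :=: f)%MS.
  apply: eqmx_trans (_ : 1%:M *m f :=: f)%MS; last by rewrite mul1mx.
  apply: eqmx_trans (eqmxMr f defC).
  apply: eqmx_trans (eqmx_sym (addsmxMr _ _ _)).
  by rewrite mulmx_ker; apply: eqmx_sym; apply: adds0mx.
have rC : \rank C = \rank <<f>>%MS.
  by rewrite genmxE -imC -{1}(mxrank_mul_ker C f) capmxC tiKC mxrank0 addn0.
have val_f : (@val_submod _ _ C _ 1%:M *m f <= <<f>>)%MS.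
  by rewrite genmxE submxMl.
exists (in_submod <<f>>%MS (@val_submod _ _ C _ 1%:M *m f)) => // [|x Gx].
  (* Since C and the image have equal rank, injectivity can be checked as surjectivity: C already
     maps onto the image. *)
  rewrite /row_free {6}rC -[_ == _]sub1mx -val_submodS in_submodK //.
  by rewrite val_submod1 genmxE (eqmxMr f (val_submod1 C)) imC.
rewrite -in_submodJ // -[_ *m f *m _]mulmxA -homf // [_ *m (rG1 x *m f)]mulmxA.
rewrite -(val_submodJ modC) // mul1mx.
by rewrite [RHS]in_submodE [in LHS]in_submodE [in RHS]val_submodE !mulmxA.
Qed.

Lemma mxtrace_ker_image (modK : mxmodule rG1 (kermx f))
    (modI : mxmodule rG2 <<f>>%MS) x :
    ([pchar F]^'.-group G) -> x \in G ->
  \tr (submod_repr modK x) + \tr (submod_repr modI x) = \tr (rG1 x).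
Proof.
move=> F'G Gx.
have [C modC defC dxC] := mx_Maschke_pchar rG1 F'G modK (submx1 _).
rewrite -(mxtrace_rsim (hom_image_rsim modC modI defC dxC)) //.
rewrite (mxtrace_dadd_mod modK modC (mxmodule1 rG1)) //.
exact: mxtrace_submod1.
Qed.

End HomImage.

(** An instance of the second isomorphism theorem: the section is (U + V) / U. It identifies
    homology with cycles when the boundaries vanish. *)
Lemma mx_rsim_section_cap0 (F : fieldType) (gT : finGroupType)
    (G : {group gT}) n (rG : mx_representation F G n) (U V : 'M_n)
    (modU : mxmodule rG U) (modV : mxmodule rG V) :
  (U :&: V = 0)%MS -> mx_rsim (submod_repr modV) (section_repr modU modV).
Proof.
move=> tiUV; pose S := <<in_factmod U V>>%MS.
have rV : \rank V = \rank S.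
  apply: (@addIn (\rank U)); rewrite genmxE mxrank_in_factmod.
  by rewrite mxrank_disjoint_sum // addnC.
have val_S : (in_factmod U (@val_submod _ _ V _ 1%:M) <= S)%MS.
  by rewrite genmxE submxMr ?val_submod1.
exists (in_submod S (in_factmod U (@val_submod _ _ V _ 1%:M))) => // [|x Gx].
  rewrite /row_free {6}rV -[_ == _]sub1mx -val_submodS in_submodK //.
  by rewrite val_submod1 genmxE submxMr ?val_submod1.
rewrite -in_submodJ // -in_factmodJ // -(val_submodJ modV) // mul1mx.
rewrite [RHS]in_submodE [in LHS]in_submodE.
by rewrite [in RHS]in_factmodE [in LHS]in_factmodE [in RHS]val_submodE !mulmxA.
Qed.

(** * Equal traces imply isomorphism in characteristic 0 *)

Section TraceDeterminesModule.

Variables (F : fieldType) (gT : finGroupType) (G : {group gT}).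
Hypothesis char0 : [pchar F] =i pred0.

Let nat_neq0 n : (n%:R == 0 :> F) = (n == 0)%N.
Proof. by move: n; apply/pcharf0P. Qed.

Lemma nonzero_hom_of_mxtrace n1 n2
    (rG1 : mx_representation F G n1) (rG2 : mx_representation F G n2) :
    (0 < n1)%N -> {in G, forall x, \tr (rG1 x) = \tr (rG2 x)} ->
  exists2 f : 'M[F]_(n1, n2), f != 0 &
    {in G, forall x, rG1 x *m f = f *m rG2 x}.
Proof.
move=> n1_gt0 eqtr.
have nzG : #|G|%:R != 0 :> F by rewrite nat_neq0 -lt0n cardG_gt0.
have nz_tr : \tr (lin_mx (average_mx rG1 rG2)) != 0.
  have -> : \tr (lin_mx (average_mx rG1 rG2)) = \tr (lin_mx (average_mx rG1 rG1)).
    rewrite !mxtrace_average_mx; congr (_ * _).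
    by apply: eq_bigr => x Gx; rewrite -eqtr.
  (* The trace of the idempotent is its rank, which is nonzero because the identity matrix is its
     own average. *)
  rewrite mxtrace_idempotent ?nat_neq0 ?mxrank_eq0.
    apply/eqP=> /(congr1 (mulmx (mxvec 1%:M))); rewrite mul_vec_lin mulmx0.
    rewrite /= average_mx_fix // => [/eqP|x _]; last by rewrite mulmx1 mul1mx.
    by rewrite mxvec_eq0 -mxrank_eq0 mxrank1 eqn0Ngt n1_gt0.
  apply/row_matrixP=> k; rewrite row_mul rowE.
  have [i j] := mxvec_indexP k.
  rewrite -mxvec_delta !mul_vec_lin /= average_mx_fix // => x Gx.
  exact: average_mx_hom.
(* The trace is a sum of coefficients of averages of elementary matrices, so one of these averages
   is nonzero. *)
have [M nzM | M0] := pickP (fun ij : 'I_n1 * 'I_n2 =>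
  average_mx rG1 rG2 (delta_mx ij.1 ij.2) != 0).
  exists (average_mx rG1 rG2 (delta_mx M.1 M.2)) => // x.
  exact: average_mx_hom.
case/eqP: nz_tr; rewrite mxtrace_lin_mx big1 // => i _; rewrite big1 // => j _.
by move: (M0 (i, j)) => /eqP /= ->; rewrite mxE.
Qed.

Theorem mx_rsim_of_mxtrace n1 n2
    (rG1 : mx_representation F G n1) (rG2 : mx_representation F G n2) :
  {in G, forall x, \tr (rG1 x) = \tr (rG2 x)} -> mx_rsim rG1 rG2.
Proof.
have [m] := ubnP n1; elim: m n1 n2 rG1 rG2 => // m IHm n1 n2 rG1 rG2 n1m eqtr.
have /eqP n12 : n1 == n2.
  have := eqtr 1%g (group1 G); rewrite !repr_mx1 !mxtrace1 => /eqP.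
  by rewrite -subr_eq0; case: (leqP n1 n2) => [|/ltnW] le;
    [rewrite -opprB oppr_eq0|]; rewrite -natrB // nat_neq0 subn_eq0 => ge;
    rewrite eqn_leq le ge.
have [n1z | n1_gt0] := posnP n1.
  exists 0 => // [|x _]; last by rewrite mulmx0 mul0mx.
  by rewrite /row_free mxrank0 n1z.
have [f nzf homf] := nonzero_hom_of_mxtrace n1_gt0 eqtr.
have F'G : [pchar F]^'.-group G by apply: pchar0_pgroup.
have modK := hom_ker_module homf; have modI := hom_image_module homf.
have [C modC defC dxC] := mx_Maschke_pchar rG1 F'G modK (submx1 _).
have [D modD defD dxD] := mx_Maschke_pchar rG2 F'G modI (submx1 _).
have simCI := hom_image_rsim homf modC modI defC dxC.
have simKD : mx_rsim (submod_repr modK) (submod_repr modD).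
  apply: IHm => [|x Gx].
    rewrite -ltnS (leq_trans _ n1m) // ltnS mxrank_ker.
    by rewrite ltn_subrL n1_gt0 lt0n mxrank_eq0 nzf.
  (* Both traces split, and the contributions of the isomorphic summands C and im f cancel. *)
  have := mxtrace_dadd_mod modK modC (mxmodule1 rG1) defC dxC Gx.
  have := mxtrace_dadd_mod modI modD (mxmodule1 rG2) defD dxD Gx.
  rewrite !(mxtrace_submod1 (mxmodule1 _) (eqmx_refl _)) // -eqtr //.
  rewrite -(mxtrace_rsim simCI) // => <-.
  by rewrite addrC => /addrI.
have dxDI : mxdirect (D + <<f>>).
  by apply/mxdirect_addsP; rewrite capmxC; apply/mxdirect_addsP.
have defDI : (D + <<f>> :=: 1%:M)%MS by rewrite addsmxC.
(* Both modules are now compared with the direct sum of D and im f. *)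
have sim1 := mx_rsim_dadd (rU := Representation (submod_repr modD))
  (rV := Representation (submod_repr modI)) (mxmodule1 rG1) defC dxC simKD simCI.
have sim2 := mx_rsim_dadd (rU := Representation (submod_repr modD))
  (rV := Representation (submod_repr modI)) (mxmodule1 rG2) defDI dxDI
  (mx_rsim_refl _) (mx_rsim_refl _).
apply: mx_rsim_trans (rsim_submod1 (mxmodule1 rG2) (eqmx_refl _)).
apply: mx_rsim_trans (mx_rsim_trans sim1 (mx_rsim_sym sim2)).
exact: mx_rsim_sym (rsim_submod1 (mxmodule1 rG1) (eqmx_refl _)).
Qed.

End TraceDeterminesModule.


(** * Counting superwords over a set of letters *)

Section SuperwordCount.

Variables (A : finType) (D : {set A}).

Lemma sum_tuple_cons (R : nmodType) q (P : seq A -> R) :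
  \sum_(t : q.+1.-tuple A) P t = \sum_(a : A) \sum_(t : q.-tuple A) P (a :: t).
Proof.
pose h (at_ : A * q.-tuple A) := cons_tuple at_.1 at_.2.
rewrite pair_bigA /= (reindex h) //=.
exists (fun t : q.+1.-tuple A => (thead t, behead_tuple t)) => [[a t] _|t _] /=.
  by rewrite theadE; congr (_, _); apply: val_inj.
by case/tupleP: t => a t; rewrite theadE; apply: val_inj.
Qed.

Lemma sum_word_tuple (R : nmodType) k q (P : seq A -> R) : (q <= k)%N ->
  \sum_(w : word A k | size (bseqval w) == q) P (bseqval w) =
  \sum_(t : q.-tuple A) P t.
Proof.
move=> qk.
pose h (t : q.-tuple A) : word A k := widen_bseq qk (bseq_of_tuple t).
rewrite (reindex_omap h (fun w : word A k => insub (bseqval w))) /=.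
  apply: eq_big => [t|t _] //.
  rewrite size_tuple eqxx insubT ?size_tuple // => tq /=.
  by apply/eqP; congr Some; apply: val_inj.
move=> w wq; rewrite insubT //=; congr Some; exact: val_inj.
Qed.

Lemma sum_all_tuple (R : pzSemiRingType) q :
  \sum_(t : q.-tuple A) (all [in D] t)%:R = (#|D| ^ q)%:R :> R.
Proof.
elim: q => [|q IHq].
  rewrite (eq_bigr (fun=> 1)) => [|t _]; last by rewrite tuple0.
  by rewrite sumr_const card_tuple expn0.
rewrite (sum_tuple_cons q (fun t => (all [in D] t)%:R)) expnS natrM -IHq.
rewrite -sum1_card natr_sum mulr_suml [RHS]big_mkcond; apply: eq_bigr => a _ /=.
by case: (a \in D); rewrite /= ?mul1r // big1.
Qed.


(* The number of words of length q over D above a fixed word of length p over D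
   depends only on p and q; x stands for #|D| - 1. *)
Fixpoint superwords (R : pzSemiRingType) (x : R) (p q : nat) : R :=
  match p, q with
  | 0, _ => (x + 1) ^+ q
  | p'.+1, 0 => 0
  | p'.+1, q'.+1 => superwords x p' q' + x * superwords x p q'
  end.

(** Read the first letter of t. If it is the first letter of u, matching it at once loses nothing;
    each of the x other letters of D leaves all of u still to be matched. *)
Lemma sum_superword_tuple (R : pzRingType) (x : R) (u : seq A) q :
    x + 1 = #|D|%:R -> all [in D] u ->
  \sum_(t : q.-tuple A) (all [in D] t && subseq u t)%:R =
  superwords x (size u) q.
Proof.
move=> xD; elim: q u => [|q IHq] [|a u] /= Du.
- by rewrite (eq_bigr (fun=> 1)) ?sumr_const ?card_tuple // => t _; rewrite tuple0.
- by rewrite big1 // => t _; rewrite tuple0.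
- rewrite xD -natrX -sum_all_tuple; apply: eq_bigr => t _.
  by rewrite sub0seq andbT.
case/andP: Du => Da Du; rewrite -(IHq u Du) -(IHq (a :: u)) /= ?Da //.
rewrite (sum_tuple_cons q (fun t => (all [in D] t && subseq (a :: u) t)%:R)).
rewrite (bigD1 a) //=; congr (_ + _).
  by apply: eq_bigr => t _; rewrite Da eqxx.
have -> : x = (\sum_(b in D | b != a) 1)%:R.
  by apply: (addIr 1); rewrite xD -sum1_card (bigD1 a) //= natrD addrC.
rewrite natr_sum mulr_suml big_mkcond [RHS]big_mkcond; apply: eq_bigr => b _ /=.
case: eqVneq => [->|ba] /=; first by rewrite andbF.
by case: (b \in D) => /=; rewrite ?mul1r // big1.
Qed.

End SuperwordCount.

(** * The superword count as a polynomial, and the coefficients c_v *)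

Section SuperwordFormula.

Variables (R : comPzRingType) (x : R).

Lemma superwords_gt p q : (q < p)%N -> superwords x p q = 0.
Proof.
elim: q p => [|q IHq] [|p] //= qp.
by rewrite IHq // IHq ?mulr0 ?addr0 // ltnW.
Qed.

(** Here j counts the letters skipped before the leftmost embedding of the p letters is complete.
    They are distributed over p gaps with x choices each, and the last m - j letters are free. *)
Lemma superwordsE p m :
  superwords x p (p + m) =
  \sum_(j < m.+1) 'C((p + j).-1, j)%:R * (x + 1) ^+ (m - j) * x ^+ j.
Proof.
elim: p m => [|p IHp] m.
  (* For p = 0 only j = 0 survives: the truncated predecessor gives ['C(0, 0)] there, and the
     binomial of j - 1 over j vanishes for positive j. *)
  rewrite big_ord_recl big1 => [|j _]; last first.
    by rewrite lift0 add0n bin_small ?mul0r.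
  by rewrite subn0 addr0 mulr1 mul1r; case: m.
elim: m => [|m IHm].
  have := IHp 0%N; rewrite !addn0 /= (@superwords_gt p.+1) // mulr0 addr0 => ->.
  by rewrite !big_ord1 !addn0 !bin0.
have -> : superwords x p.+1 (p.+1 + m.+1) =
          superwords x p (p + m.+1) + x * superwords x p.+1 (p.+1 + m).
  by rewrite [in LHS]addSn /= !addnS.
rewrite IHp IHm !(big_ord_recl m.+1) -addrA; congr (_ + _).
  by rewrite !bin0.
(* With the terms j = 0 removed, the remaining identity is Pascal's rule for
   ['C(p + j.+1, j.+1)]. *)
rewrite mulr_sumr -big_split; apply: eq_bigr => j _.
rewrite !lift0 !addSn !addnS /= subSS binS natrD exprS; ring.
Qed.

(** Binomial expansion of (x + 1)^(n - j), with v = i + j. The guard is needed since for v < j the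
    truncated [v - j] would contribute a binomial equal to 1. *)
Lemma sum_binomial_shift n j : (0 < j <= n)%N ->
  \sum_(1 <= v < n.+1 | (j <= v)%N) 'C(n - j, v - j)%:R * x ^+ v =
  (x + 1) ^+ (n - j) * x ^+ j.
Proof.
case/andP=> j_gt0 jn; rewrite big_mkcond (@big_cat_nat _ _ _ j) //=; last exact: leqW.
rewrite big_nat big1 ?add0r => [|v /andP[_]]; last by rewrite ltnNge => /negbTE->.
rewrite -{1}[j]add0n big_addn big_mkord subSn // addrC exprDn mulr_suml.
apply: eq_bigr => i _; rewrite leq_addl addnK expr1n mul1r exprD.
by rewrite -mulr_natl; ring.
Qed.

(** After multiplication by (x + 1)^s1, the j-th term of [superwordsE] contains (x + 1)^(s2 - j)
    x^j. The term j = 0 is (x + 1)^s2, which is why c_v starts at j = 1; the others are expanded in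
    powers of x and the sums exchanged. *)
Lemma sum_coef_c s1 s2 : (0 < s1 <= s2)%N ->
  (x + 1) ^+ s1 * superwords x s1 s2 =
  (x + 1) ^+ s2 + \sum_(1 <= v < s2.+1) (coef_c s1 s2 v)%:R * x ^+ v.
Proof.
case/andP=> s1_gt0 s12; set m := (s2 - s1)%N.
have ms2 : (m <= s2)%N by rewrite leq_subr.
rewrite -[in superwords _ _ _](subnKC s12) -/m superwordsE mulr_sumr big_ord_recl.
congr (_ + _).
  by rewrite bin0 subn0 mul1r mulr1 -exprD subnKC.
transitivity (\sum_(1 <= v < s2.+1) \sum_(1 <= j < m.+1 | (j <= v)%N)
                ('C(s2 - j, v - j) * 'C(s1 + j - 1, j))%:R * x ^+ v).
  rewrite (exchange_big_dep_nat xpredT) //= big_add1 /= big_mkord.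
  apply: eq_bigr => j _; rewrite /bump /= add1n.
  transitivity ('C(s1 + j.+1 - 1, j.+1)%:R * ((x + 1) ^+ (s2 - j.+1) * x ^+ j.+1)).
    have -> : (s2 - j.+1 = s1 + (m - j.+1))%N by have := ltn_ord j; lia.
    by rewrite subn1 exprD; ring.
  rewrite -sum_binomial_shift ?mulr_sumr; last by have := ltn_ord j; lia.
  by apply: eq_bigr => v _; rewrite natrM; ring.
rewrite !big_nat; apply: eq_bigr => v /andP[v1 v2].
rewrite /coef_c -/m natr_sum mulr_suml.
(* The two conditions [j <= v] and [j <= m] are the bound [minn v m] in [coef_c]. *)
rewrite [RHS](big_nat_widen _ _ m.+1) ?ltnS ?geq_minr //.
rewrite [LHS]big_nat_cond [RHS]big_nat_cond; apply: eq_bigl => j; lia.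
Qed.

End SuperwordFormula.

Lemma coef_c_gt0 s1 s2 v : (0 < s1 < s2)%N -> (1 <= v <= s2)%N ->
  (0 < coef_c s1 s2 v)%N.
Proof.
move=> s12 vs2; rewrite /coef_c big_ltn; last by lia.
by rewrite ltn_addr // muln_gt0 !bin_gt0; lia.
Qed.

(** The term j = 1 suffices: it is s1 C(s2 - 1, v - 1), at least s1 C(s1, v - 1), while v C(s1, v) =
    (s1 - v + 1) C(s1, v - 1). *)
Lemma bin_leq_coef_c s1 s2 v : (0 < s1 < s2)%N -> (1 <= v <= s1)%N ->
  ('C(s1, v) <= coef_c s1 s2 v)%N.
Proof.
case: v => // v s12 vs1; rewrite /coef_c big_ltn; last by lia.
apply: leq_trans (leq_addr _ _); rewrite addnK bin1 !subn1 /=.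
apply: leq_trans (_ : 'C(s1, v) * s1 <= _)%N; last first.
  by rewrite leq_mul2r leq_bin2l ?orbT //; lia.
have := mul_bin_left s1 v; have := leq_subr v s1; nia.
Qed.

Lemma mxtrace_perm_module (F : fieldType) (gT : finGroupType) (T : finType)
    (to : {action gT &-> T}) (X : {set T}) (actX : [acts [set: gT], on X | to])
    (g : gT) :
  \tr (perm_module F actX g) = #|[set x in X | to x g == x]|%:R.
Proof.
transitivity (\sum_(i < #|X|) (to (enum_val i) g == enum_val i)%:R : F).
  by apply: eq_bigr => i _; rewrite mxE.
rewrite -(big_enum_val (fun x => (to x g == x)%:R : F)) -sum1_card natr_sum.
rewrite big_mkcond [RHS]big_mkcond; apply: eq_bigr => x _; rewrite !inE.
by case: (x \in X); case: (to x g == x).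
Qed.

Lemma ord2_neq1 (r : 'I_2) : r != 1 -> r = 0.
Proof.
by case: r => -[|[|//]] lt2 /eqP r1; apply: val_inj => //; case: r1; apply: val_inj.
Qed.

(** * The Specht module of shape (n-1, 1) *)

Section StandardModule.

Variables (F : fieldType) (A : finType) (m : nat).
Hypothesis cardA : #|A| = m.+2.

Local Notation shape := [:: m.+1; 1%N].
Local Notation Tabloids := (tabloids A shape).

(** A tabloid of this shape is determined by the one letter in its second row, which has index 1. *)
Definition letter_tabloid (b : A) : {ffun A -> 'I_2} :=
  [ffun a => if a == b then 1 else 0].

Lemma letter_tabloid_inj : injective letter_tabloid.
Proof.
move=> a b /ffunP/(_ a); rewrite !ffunE eqxx.
by case: eqP.
Qed.

Lemma letter_tabloidP (f : {ffun A -> 'I_2}) :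
  reflect (exists b, f = letter_tabloid b) (f \in Tabloids).
Proof.
apply: (iffP idP) => [|[b ->]].
  rewrite inE => /forallP/(_ 1)/cards1P[b fb]; exists b; apply/ffunP=> a.
  have := in_set1 a b; rewrite -fb inE ffunE => <-.
  by case: eqVneq => [//|/ord2_neq1].
rewrite inE; apply/forallP=> r.
have e1 : [set a | letter_tabloid b a == 1] = [set b].
  by apply/setP=> a; rewrite !inE ffunE; case: (a == b).
have [->|r0] := eqVneq r 1; first by rewrite e1 cards1.
rewrite (ord2_neq1 r0).
rewrite /= -eqSS -cardA -(cardsC [set a | letter_tabloid b a == 1]) e1 cards1.
rewrite add1n eqSS; apply/eqP/eq_card=> a; rewrite !inE ffunE.
by case: (a == b).
Qed.

Lemma letter_tabloid_act (b : A) (g : {perm A}) :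
  ffun_act (letter_tabloid b) g = letter_tabloid (g b).
Proof.
by apply/ffunP=> a; rewrite !ffunE -(inj_eq (@perm_inj _ g)) permKV.
Qed.

Lemma card_fixed_tabloids (g : {perm A}) :
  #|[set f in Tabloids | ffun_action A _ f g == f]| = #|[set a | g a == a]|.
Proof.
rewrite -(card_imset _ letter_tabloid_inj); apply: eq_card => f.
rewrite inE; apply/andP/imsetP => [[/letter_tabloidP[b ->]] /eqP gb | [b]].
  exists b => //; rewrite inE; apply/eqP/letter_tabloid_inj.
  by rewrite -letter_tabloid_act.
rewrite inE => /eqP gb ->; split; first by apply/letter_tabloidP; exists b.
by rewrite /= letter_tabloid_act gb.
Qed.

Definition letter_row (b : A) : 'rV[F]_#|Tabloids| :=
  \row_j (enum_val j == letter_tabloid b)%:R.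

(** Column 0 consists of a and b, and every other column has a single cell, so the column stabiliser
    is {1, (a b)}. The transposition puts a in the second row, with sign -1. *)
Lemma polytabloidE (t : {ffun A -> 'I_2 * 'I_m.+1}) (a b : A) :
    @tableau A shape t -> t a = (0, 0) -> t b = (1, 0) ->
  @polytabloid F A shape t = letter_row b - letter_row a.
Proof.
case/andP=> /injectiveP inj_t /forallP lt_t ta tb.
have ab : a != b by apply/eqP=> e; move: tb; rewrite -e ta.
have col0 c : (t c).2 = 0 -> (c == a) || (c == b).
  move=> tc; rewrite -!(inj_eq inj_t) ta tb.
  case: (t c) tc => r y /= ->; rewrite !xpair_eqE !eqxx !andbT orbC.
  by case: (eqVneq r 1) => //= /ord2_neq1 ->.
have colS c : (t c).2 != 0 -> (t c).1 = 0.
  have := lt_t c; case: (t c) => -[[|[|//]] lt2] y /=.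
    by move=> *; apply: val_inj.
  by case: y => -[].
have stab : @column_stab A shape t = [set 1%g; tperm a b].
  apply/setP=> s; rewrite !inE; apply/forallP/orP => [st|[/eqP->|/eqP->] c].
  - have fixc c : c != a -> c != b -> s c = c.
      move=> ca cb; apply: inj_t; have /eqP e2 := st c.
      have nz : (t c).2 != 0 by apply/eqP=> /col0; rewrite (negbTE ca) (negbTE cb).
      have e1 : (t (s c)).1 = (t c).1 by rewrite !colS // e2.
      by rewrite [LHS]surjective_pairing e1 e2 -surjective_pairing.
    have sab c : (t c).2 = 0 -> (s c == a) || (s c == b).
      by move=> tc; apply: col0; have /eqP -> := st c.
    have sa := sab a; rewrite ta in sa; have {sa} sa := sa erefl.
    have sb := sab b; rewrite tb in sb; have {sb} sb := sb erefl.
    have nsab : s a != s b by rewrite (inj_eq perm_inj).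
    case/orP: sa => /eqP sa.
      left; apply/eqP/permP=> c; rewrite perm1.
      have [->//|ca] := eqVneq c a; have [->|cb] := eqVneq c b; last exact: fixc.
      by move: sb nsab; rewrite sa => /orP[/eqP->|/eqP//]; rewrite eqxx.
    right; apply/eqP/permP=> c.
    have [->|ca] := eqVneq c a; first by rewrite tpermL.
    have [->|cb] := eqVneq c b; last by rewrite tpermD 1?eq_sym // fixc.
    rewrite tpermR.
    by move: sb nsab; rewrite sa => /orP[/eqP//|/eqP->]; rewrite eqxx.
  - by rewrite perm1.
  - by case: tpermP => // ->; rewrite ta tb.
have tab : @tabloid_of A shape t = letter_tabloid b.
  apply/ffunP=> c; rewrite !ffunE -(inj_eq inj_t) tb.
  have -> : (t c == (1, 0)) = ((t c).1 == 1).
    case: (t c) (lt_t c) => r y /=; rewrite xpair_eqE.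
    by case: eqVneq => //= -> /=; rewrite ltnS leqn0.
  by case: eqVneq => [|/ord2_neq1].
have one_tau : (1%g : {perm A}) != tperm a b.
  by apply/eqP=> /permP/(_ a); rewrite perm1 tpermL => e; rewrite e eqxx in ab.
apply/rowP=> j; rewrite !mxE stab big_mkcondr big_setU1 ?inE //= big_set1.
rewrite odd_perm1 odd_tperm ab expr0 expr1 tab !letter_tabloid_act perm1 tpermR.
rewrite ![letter_tabloid _ == _]eq_sym.
by case: eqP; case: eqP => /=; rewrite ?subr0 ?sub0r ?addr0 ?add0r.
Qed.

Lemma exists_tableau (a b : A) : a != b ->
  exists t : {ffun A -> 'I_2 * 'I_m.+1},
    [/\ @tableau A shape t, t a = (0, 0) & t b = (1, 0)].
Proof.
(* The list s is the first row: a comes first, then all letters other than a and b. *)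
move=> ab; pose s := a :: [seq c <- enum A | (c != a) && (c != b)].
have mem_s c : (c \in s) = (c != b).
  rewrite inE mem_filter mem_enum andbT.
  by case: (eqVneq c a) => [->|] /=; rewrite ?ab.
have size_s : size s = m.+1.
  have uniq_s : uniq s.
    by rewrite /= mem_filter eqxx /= filter_uniq ?enum_uniq.
  have := cardC1 b; rewrite cardA -(card_uniqP uniq_s) /= => <-.
  by apply: eq_card => c; rewrite mem_s.
have idx_a : index a s = 0%N by rewrite /= eqxx.
clearbody s; exists [ffun c => if c == b then (1, 0) else (0, inord (index c s))].
split; last 2 first.
- by rewrite ffunE (negbTE ab) idx_a; congr (_, _); apply: val_inj; rewrite /= inordK.
- by rewrite ffunE eqxx.
have lt_index c : c != b -> (index c s < m.+1)%N by rewrite -size_s index_mem mem_s.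
apply/andP; split; last first.
  by apply/forallP=> c; rewrite ffunE; case: eqP.
apply/injectiveP=> c d; rewrite !ffunE.
case: (eqVneq c b) => [->|cb]; case: (eqVneq d b) => [->|db] // [].
move/(congr1 (@nat_of_ord _)).
rewrite !inordK ?lt_index // => e; rewrite -[c](nth_index a (s := s)) ?mem_s //.
by rewrite e nth_index ?mem_s.
Qed.

(** By the pigeonhole principle two of the m + 2 letters share one of the m + 1 columns. They lie in
    different rows, and the second row has only the cell in column 0. *)
Lemma tableau_col0 (t : {ffun A -> 'I_2 * 'I_m.+1}) : @tableau A shape t ->
  exists a b, t a = (0, 0) /\ t b = (1, 0).
Proof.
case/andP=> /injectiveP inj_t /forallP lt_t.
have row1 b : (t b).1 = 1 -> t b = (1, 0).
  case: (t b) (lt_t b) => r y /= lty r1; rewrite r1 /= ltnS leqn0 in lty *.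
  by congr (_, _); apply/eqP.
have : ~~ injectiveb (fun c => (t c).2).
  apply: contraL isT => /injectiveP/leq_card; rewrite cardA card_ord.
  by rewrite ltnn.
case/injectivePn=> a [b ab e2].
have ne1 : (t a).1 != (t b).1.
  apply: contraNneq ab => e1; apply/eqP/inj_t.
  by rewrite [LHS]surjective_pairing e1 e2 -surjective_pairing.
have [a1|/ord2_neq1 a0] := eqVneq ((t a).1) 1; [exists b, a | exists a, b].
  rewrite a1 eq_sym in ne1; rewrite (row1 a a1) /= in e2 *; split=> //.
  by rewrite [LHS]surjective_pairing -e2 (ord2_neq1 ne1).
have b1 : (t b).1 = 1 by apply/eqP; apply: contraNT ne1 => /ord2_neq1 ->; rewrite a0.
by rewrite (row1 b b1) /= in e2 *; split=> //; rewrite [LHS]surjective_pairing e2 a0.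
Qed.

Lemma letter_row_sum b : letter_row b *m (const_mx 1 : 'cV_#|Tabloids|) = 1%:M.
Proof.
apply/rowP=> i; rewrite ord1 !mxE.
transitivity (\sum_(j < #|Tabloids|) (enum_val j == letter_tabloid b)%:R : F).
  by apply: eq_bigr => j _; rewrite !mxE mulr1.
rewrite -(big_enum_val (fun f => (f == letter_tabloid b)%:R : F)).
rewrite (bigD1 (letter_tabloid b)) ?eqxx /=; last by apply/letter_tabloidP; exists b.
by rewrite big1 ?addr0 // => f /andP[_ /negbTE ->].
Qed.

(** Polytabloids are the differences of two basis vectors, and these differences span the vectors
    with coordinate sum 0. *)
Lemma specht_mx_standard :
  (specht_mx F A shape :=: kermx (const_mx 1 : 'cV_#|Tabloids|))%MS.
Proof.
apply/eqmxP/andP; split.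
  apply/sumsmx_subP=> t tabt; rewrite genmxE; apply/sub_kermxP.
  have [a [b [ta tb]]] := tableau_col0 tabt.
  by rewrite (polytabloidE tabt ta tb) mulmxBl !letter_row_sum subrr.
have [b0 _] : exists b0 : A, b0 \in A by apply/card_gt0P; rewrite cardA.
have /fin_all_exists[beta defb] (j : 'I_#|Tabloids|) :
    exists b, enum_val j = letter_tabloid b.
  exact/letter_tabloidP/enum_valP.
have rowb j : letter_row (beta j) = delta_mx 0 j.
  by apply/rowP=> k; rewrite !mxE -defb (inj_eq enum_val_inj) eqxx.
apply/rV_subP=> v /sub_kermxP v0.
have sumv : \sum_j v 0 j = 0.
  move/rowP/(_ 0): v0; rewrite !mxE => {2}<-.
  by apply: eq_bigr => j _; rewrite mxE mulr1.
(* The subtracted multiples of [letter_row b0] add up to zero because the coordinates of v do. *)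
have -> : v = \sum_j v 0 j *: (letter_row (beta j) - letter_row b0).
  rewrite {1}[v]row_sum_delta; under [RHS]eq_bigr do rewrite scalerBr.
  rewrite sumrB -scaler_suml sumv scale0r subr0.
  by apply: eq_bigr => j _; rewrite rowb.
apply: summx_sub => j _; apply: scalemx_sub.
have [->|nb] := eqVneq b0 (beta j); first by rewrite subrr sub0mx.
have [t [tabt ta tb]] := exists_tableau nb.
by rewrite -(polytabloidE tabt ta tb) (sumsmx_sup t) ?genmxE.
Qed.

(** The coordinate sum maps the permutation module on letters onto the trivial module, with the
    Specht module as kernel. *)
Lemma mxtrace_specht_standard (g : {perm A}) : [pchar F] =i pred0 ->
  \tr (specht F A shape g) = #|[set a | g a == a]|%:R - 1.
Proof.
move=> char0; pose e : 'cV[F]_#|Tabloids| := const_mx 1.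
pose rT := MxRepresentation (trivial_mx_repr F [group of [set: {perm A}]]).
have hom_e : {in [set: {perm A}], forall x,
    perm_module F (tabloids_acts A shape) x *m e = e *m rT x}.
  move=> x _; apply/colP=> i; rewrite mulmx1.
  have [j ij] := perm_module_imageP (tabloids_acts A shape) x i.
  by rewrite (perm_module_mul _ _ ij) !mxE.
have F'G : [pchar F]^'.-group [set: {perm A}] by apply: pchar0_pgroup.
have iso_e := eqmx_iso (perm_module F (tabloids_acts A shape)) specht_mx_standard.
have modK := hom_ker_module hom_e; have modI := hom_image_module hom_e.
have rsimK := (mx_rsim_iso (specht_module F A shape) modK).2 iso_e.
have rank1 : (<<e>> :=: 1%:M)%MS.
  have [b0 _] : exists b0 : A, b0 \in A by apply/card_gt0P; rewrite cardA.
  by apply/eqmxP; rewrite submx1 genmxE -(letter_row_sum b0) submxMl.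
have := mxtrace_ker_image hom_e modK modI F'G (in_setT g).
rewrite mxtrace_perm_module card_fixed_tabloids (mxtrace_submod1 modI rank1) ?inE //.
rewrite /= mxtrace1 -(mxtrace_rsim rsimK) ?inE // => <-.
by rewrite addrK.
Qed.

End StandardModule.

Lemma lt_word_size (A : finType) k (u w : word A k) :
  (u < w)%O -> (size (bseqval u) < size (bseqval w))%N.
Proof.
rewrite lt_neqAle => /andP[uw s]; rewrite ltn_neqAle size_subseq // andbT.
by apply: contra uw => /eqP e; apply/eqP/val_inj/eqP; rewrite -(size_subseq_leqif s).2 e.
Qed.

(** * The order complex of two ranks is a connected graph *)

Section TwoRanks.

Variables (F : fieldType) (A : finType) (k s1 s2 : nat).
Hypotheses (A_gt0 : (0 < #|A|)%N) (s1_gt0 : (0 < s1)%N).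
Hypotheses (s12 : (s1 < s2)%N) (s2k : (s2 <= k)%N).

Local Notation T := (word A k).
Local Notation X := (words_of_rank A k [in [:: s1; s2]]).
Local Notation chains := (@chains _ T X).
Local Notation boundary := (@boundary F _ T X).

Lemma mem_words2 (w : T) :
  (w \in X) = (size (bseqval w) == s1) || (size (bseqval w) == s2).
Proof. by rewrite !inE. Qed.

Lemma chains1E (w : T) : ([tuple w] \in chains 1) = (w \in X).
Proof. by rewrite inE /= andbT. Qed.

Lemma chains2E (u w : T) :
  ([tuple u; w] \in chains 2) =
  [&& size (bseqval u) == s1, size (bseqval w) == s2 & subseq (bseqval u) (bseqval w)].
Proof.
rewrite inE /= !andbT !mem_words2; apply/idP/idP.
  case/and3P=> lt_uw Xu Xw; have sz := lt_word_size lt_uw.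
  have suw : subseq (bseqval u) (bseqval w) := ltW lt_uw.
  rewrite suw andbT; lia.
case/and3P=> /eqP su /eqP sw uw; rewrite su sw !eqxx orbT /= andbT.
rewrite lt_neqAle; apply/andP; split; last exact: uw.
by apply/eqP=> e; move: s12; rewrite -su -sw e ltnn.
Qed.

Lemma no_chains3 : chains 3 = set0.
Proof.
apply/setP=> t; rewrite inE [RHS]inE.
case/tupleP: t => u t; case/tupleP: t => v t; case/tupleP: t => w t.
rewrite tuple0 /= !andbT !mem_words2; apply/negbTE/negP.
case/andP=> /andP[/lt_word_size uv /lt_word_size vw] /and3P[]; lia.
Qed.

Definition word_row (w : T) : 'rV[F]_#|chains 1| :=
  \row_j (enum_val j == [tuple w])%:R.

Lemma boundary0E : boundary 0 = const_mx 1.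
Proof.
apply/matrixP=> i j; rewrite !mxE big_mkcond big_ord1 expr0.
by rewrite [omit _ _]tuple0 [enum_val j]tuple0 eqxx.
Qed.

Lemma word_row_sum (w : T) : w \in X ->
  word_row w *m boundary 0 = const_mx 1.
Proof.
move=> Xw; rewrite boundary0E; apply/rowP=> i; rewrite !mxE.
transitivity (\sum_(j < #|chains 1|) (enum_val j == [tuple w])%:R : F).
  by apply: eq_bigr => j _; rewrite !mxE mulr1.
rewrite -(big_enum_val (fun f => (f == [tuple w])%:R : F)).
rewrite (bigD1 [tuple w]) ?chains1E ?eqxx //=.
by rewrite big1 ?addr0 // => f /andP[_ /negbTE ->].
Qed.

Lemma row_boundary1 (i : 'I_#|chains 2|) (u w : T) :
  enum_val i = [tuple u; w] -> row i (boundary 1) = word_row w - word_row u.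
Proof.
move=> defi; apply/rowP=> j; rewrite !mxE big_mkcond big_ord_recl big_ord1 defi.
have -> : omit ord0 [tuple u; w] = [tuple w].
  by apply: eq_from_tnth => l; rewrite tnth_mktuple ord1 !(tnth_nth u).
have -> : omit (lift ord0 ord0) [tuple u; w] = [tuple u].
  by apply: eq_from_tnth => l; rewrite tnth_mktuple !(tnth_nth u); case: l => -[|[]].
rewrite [lift _ _ : nat]lift0 expr0 expr1 ![enum_val j == _]eq_sym.
by case: (_ == enum_val j); case: (_ == enum_val j);
  rewrite /= ?subr0 ?sub0r ?addr0 ?add0r.
Qed.

Lemma boundary_mul : boundary 1 *m boundary 0 = 0.
Proof.
apply/row_matrixP=> i; rewrite row_mul row0.
have [u [w defi]] : exists u w, enum_val i = [tuple u; w].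
  case/tupleP: (enum_val i) => u t; case/tupleP: t => w t.
  by exists u, w; rewrite tuple0; apply: val_inj.
have := enum_valP i; rewrite defi chains2E.
case/and3P=> su sw _; rewrite (row_boundary1 defi) mulmxBl !word_row_sum ?subrr //.
  by rewrite mem_words2 su.
by rewrite mem_words2 sw orbT.
Qed.

Definition homologous (u w : T) := (word_row u - word_row w <= boundary 1)%MS.

Lemma homologous_sym u w : homologous u w -> homologous w u.
Proof. by rewrite /homologous -opprB (eqmx_opp _). Qed.

Lemma homologous_trans v u w : homologous u v -> homologous v w -> homologous u w.
Proof.
move=> uv vw; rewrite /homologous -[word_row u](subrK (word_row v)) -addrA.
exact: addmx_sub.
Qed.

Lemma homologous_subseq (u w : T) :
  size (bseqval u) = s1 -> size (bseqval w) = s2 ->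
  subseq (bseqval u) (bseqval w) -> homologous u w.
Proof.
move=> su sw uw; apply: homologous_sym.
have C2 : [tuple u; w] \in chains 2 by rewrite chains2E su sw uw !eqxx.
rewrite /homologous -(row_boundary1 (enum_rankK_in C2 C2)); exact: row_sub.
Qed.

(** Sequences longer than k are sent to the empty word; [word_ofK] covers the others. *)
Definition word_of (s : seq A) : T := insub_bseq k s.

Lemma word_ofK s : (size s <= k)%N -> bseqval (word_of s) = s.
Proof. by move=> sk; apply: insubdK. Qed.

(** Padding t in front with s2 - s1 - 1 copies of some letter gives a word of length s2 above both s
    and s', hence a path of two edges. *)
Lemma homologous_common (s s' t : seq A) : size s = s1 -> size s' = s1 ->
  size t = s1.+1 -> subseq s t -> subseq s' t -> homologous (word_of s) (word_of s').
Proof.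
move=> ss ss' st sub sub'.
have [a _] : exists a : A, a \in A by apply/card_gt0P.
pose w := nseq (s2 - s1.+1) a ++ t.
have sw : size w = s2 by rewrite size_cat size_nseq st; lia.
have sub_w r : subseq r t -> subseq r w.
  by move=> rt; apply: subseq_trans rt _; apply: suffix_subseq.
have s1k : (s1 <= k)%N by lia.
apply: (@homologous_trans (word_of w)); last apply: homologous_sym.
  by apply: homologous_subseq; rewrite !word_ofK ?sw ?ss // sub_w.
by apply: homologous_subseq; rewrite !word_ofK ?sw ?ss' // sub_w.
Qed.

(** Letters are changed one at a time from the left, p being the part already in agreement.
    Replacing a by b passes through the common superword p a b q. *)
Lemma homologous_rank1 (p q q' : seq A) : size (p ++ q) = s1 -> size (p ++ q') = s1 ->
  homologous (word_of (p ++ q)) (word_of (p ++ q')).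
Proof.
elim: q q' p => [|a q IHq] [|b q'] p; rewrite ?size_cat ?cats0 /=.
- by rewrite /homologous subrr sub0mx.
- by lia.
- by lia.
move=> sp sp'; apply: (@homologous_trans (word_of (p ++ b :: q))).
  apply: (@homologous_common _ _ (p ++ a :: b :: q)); rewrite ?size_cat /=; try lia.
    rewrite cat_subseq //; apply: (@cat_subseq _ [:: a] q [:: a]) => //.
    exact: subseq_cons.
  by rewrite cat_subseq // subseq_cons.
by rewrite -!cat_rcons; apply: IHq; rewrite !size_cat size_rcons; lia.
Qed.

Lemma homologous_all (u w : T) : u \in X -> w \in X -> homologous u w.
Proof.
have word_of_val (v : T) : word_of (bseqval v) = v.
  by apply: val_inj; rewrite /= word_ofK // size_bseq.
have to_rank1 (v : T) : v \in X -> exists2 s, size s = s1 & homologous v (word_of s).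
  rewrite mem_words2 => /orP[] /eqP sv.
    by exists (bseqval v); rewrite ?word_of_val // /homologous subrr sub0mx.
  (* A word of length s2 is adjacent to its prefix of length s1. *)
  exists (take s1 (bseqval v)); first by rewrite size_takel // sv ltnW.
  apply: homologous_sym; apply: homologous_subseq => //.
    by rewrite word_ofK ?size_takel ?sv // ?(ltnW s12) //; lia.
  rewrite word_ofK ?take_subseq // size_takel ?sv ?(ltnW s12) //; lia.
move=> /to_rank1[s ss us] /to_rank1[t st wt].
apply: homologous_trans us (homologous_trans _ (homologous_sym wt)).
exact: (@homologous_rank1 [::]).
Qed.

Lemma word2_exists : exists w : T, w \in X.
Proof.
have [a _] : exists a : A, a \in A by apply/card_gt0P.
by exists (word_of (nseq s1 a)); rewrite mem_words2 word_ofK size_nseq ?eqxx //; lia.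
Qed.

(** Reduced homology vanishes in degree 0: chains of coordinate sum 0 are spanned by differences of
    vertices, which are boundaries by connectedness. *)
Lemma boundary_exact : (boundary 1 :=: kermx (boundary 0))%MS.
Proof.
apply/eqmxP/andP; split; first exact/sub_kermxP/boundary_mul.
have [w0 Xw0] := word2_exists.
have /fin_all_exists2[beta Xbeta defb] (j : 'I_#|chains 1|) :
    exists2 w, w \in X & enum_val j = [tuple w].
  have := enum_valP j; case/tupleP: (enum_val j) => w t.
  by rewrite tuple0 chains1E; exists w.
have rowb j : word_row (beta j) = delta_mx 0 j.
  by apply/rowP=> l; rewrite !mxE -defb (inj_eq enum_val_inj) eqxx.
have C0 : [tuple] \in chains 0 by rewrite inE.
apply/rV_subP=> v /sub_kermxP v0.
have sumv : \sum_j v 0 j = 0.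
  move/rowP/(_ (enum_rank_in C0 [tuple])): v0; rewrite boundary0E !mxE => {2}<-.
  by apply: eq_bigr => j _; rewrite mxE mulr1.
have -> : v = \sum_j v 0 j *: (word_row (beta j) - word_row w0).
  rewrite {1}[v]row_sum_delta; under [RHS]eq_bigr do rewrite scalerBr.
  rewrite sumrB -scaler_suml sumv scale0r subr0.
  by apply: eq_bigr => j _; rewrite rowb.
by apply: summx_sub => j _; apply: scalemx_sub; apply: homologous_all.
Qed.

End TwoRanks.

(** * The trace of a permutation on the homology *)

Section TwoRankTrace.

Variables (F : fieldType) (A : finType) (k s1 s2 : nat).
Hypotheses (A_gt0 : (0 < #|A|)%N) (s1_gt0 : (0 < s1)%N).
Hypotheses (s12 : (s1 < s2)%N) (s2k : (s2 <= k)%N).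
Hypothesis char0 : [pchar F] =i pred0.

Local Notation T := (word A k).
Local Notation X := (words_of_rank A k [in [:: s1; s2]]).
Local Notation chains := (@chains _ T X).
Local Notation boundary := (@boundary F _ T X).
Local Notation chain_module :=
  (chain_module F (@word_action_mono A k) (words_of_rank_acts A k [in [:: s1; s2]])).

Variable g : {perm A}.
Local Notation D := [set a | g a == a].
Local Notation x := (#|D|%:R - 1 : F).

Lemma word_fixedE (w : T) : (word_action A k w g == w) = all [in D] (bseqval w).
Proof.
rewrite -val_eqE /=; elim: (bseqval w) => //= a s <-.
by rewrite eqseq_cons inE.
Qed.

Lemma mxtrace_chain1 : \tr (chain_module 1 g) = (#|D| ^ s1)%:R + (#|D| ^ s2)%:R.
Proof.
rewrite mxtrace_perm_module -sum1_card natr_sum.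
pose P (t : seq T) := (all [in X] t && all (fun w => all [in D] (bseqval w)) t)%:R : F.
transitivity (\sum_(t : 1.-tuple T) P t).
  rewrite big_mkcond; apply: eq_bigr => t _; rewrite /P inE.
  have [w ->] : exists w, t = [tuple w].
    by case/tupleP: t => w t; exists w; rewrite tuple0; apply: val_inj.
  rewrite chains1E -val_eqE /= eqseq_cons word_fixedE !andbT.
  by case: (_ && _).
rewrite (sum_tuple_cons 0 P).
transitivity (\sum_(w : T)
  ((if size (bseqval w) == s1 then (all [in D] (bseqval w))%:R else 0) +
   (if size (bseqval w) == s2 then (all [in D] (bseqval w))%:R else 0) : F)).
  apply: eq_bigr => w _.
  rewrite (eq_bigr (fun=> P [:: w])) => [|t _]; last by rewrite tuple0.
  rewrite sumr_const card_tuple expn0 /P /= !andbT mem_words2.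
  have := s12; case: eqP => [->|_] /=; last by rewrite add0r; case: ifP.
  by move/ltn_eqF ->; rewrite addr0.
rewrite big_split -!big_mkcond.
rewrite (sum_word_tuple (fun s => (all [in D] s)%:R : F)); last by lia.
by rewrite (sum_word_tuple (fun s => (all [in D] s)%:R : F)) // !sum_all_tuple.
Qed.

(** An edge is fixed exactly when both its words are over D. There are |D|^s1 such lower words, all
    with equally many superwords over D of length s2. *)
Lemma mxtrace_chain2 : \tr (chain_module 2 g) = #|D|%:R ^+ s1 * superwords x s1 s2.
Proof.
rewrite mxtrace_perm_module -sum1_card natr_sum.
pose Q (u w : seq A) := [&& all [in D] u, all [in D] w & subseq u w].
pose P (t : seq T) := (if t is [:: u; w] then
  [&& size (bseqval u) == s1, size (bseqval w) == s2 &
      Q (bseqval u) (bseqval w)] else false)%:R : F.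
transitivity (\sum_(t : 2.-tuple T) P t).
  rewrite big_mkcond; apply: eq_bigr => t _; rewrite /P inE.
  have [u [w ->]] : exists u w, t = [tuple u; w].
    case/tupleP: t => u t; case/tupleP: t => w t.
    by exists u, w; rewrite tuple0; apply: val_inj.
  rewrite chains2E // -val_eqE /= !eqseq_cons !word_fixedE !andbT /Q.
  rewrite -!andbA; do !case: (_ == _) => //=.
  by rewrite andbC -!andbA; case: (_ && _).
rewrite (sum_tuple_cons 1 P).
transitivity (\sum_(u : T | size (bseqval u) == s1)
  \sum_(w : T | size (bseqval w) == s2) (Q (bseqval u) (bseqval w))%:R : F).
  rewrite [RHS]big_mkcond; apply: eq_bigr => u _.
  rewrite (sum_tuple_cons 0 (fun t => P (u :: t))).
  rewrite (eq_bigr (fun w => P [:: u; w])) => [|w _]; last first.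
    rewrite (eq_bigr (fun=> P [:: u; w])) => [|t _]; last by rewrite tuple0.
    by rewrite sumr_const card_tuple expn0.
  rewrite /P; case: eqP => _ /=; last by rewrite big1.
  by rewrite [RHS]big_mkcond; apply: eq_bigr => w _; case: eqP.
under eq_bigr do rewrite (sum_word_tuple (fun s => (Q _ s)%:R : F)) //.
rewrite (sum_word_tuple (fun u => \sum_(t : s2.-tuple A) (Q u t)%:R : F)); last by lia.
rewrite -natrX -sum_all_tuple mulr_suml; apply: eq_bigr => u _.
rewrite /Q; case: (boolP (all _ u)) => Du /=; last by rewrite mul0r big1.
rewrite mul1r -[X in superwords _ X _](size_tuple u).
by rewrite -(sum_superword_tuple s2 (u := u) (D := D)) // subrK.
Qed.

(** The Hopf trace formula: each chain module splits its trace between kernel and image of its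
    boundary map, and only the homology in degree 1 survives. *)
Lemma mxtrace_word_homology :
  \tr (word_homology A k F [in [:: s1; s2]] 1 g) =
  #|D|%:R ^+ s1 * superwords x s1 s2 - ((#|D| ^ s1)%:R + (#|D| ^ s2)%:R) + 1.
Proof.
have F'G : [pchar F]^'.-group [set: {perm A}] by apply: pchar0_pgroup.
have hom p : {in [set: {perm A}], forall h,
    chain_module p.+1 h *m boundary p = boundary p *m chain_module p h}.
  by move=> h _; apply: boundary_hom.
have no3 : #|chains 3| = 0%N by rewrite no_chains3 ?cards0.
rewrite -mxtrace_chain1 -mxtrace_chain2.
(* Without chains of three vertices there are no boundaries in degree 1, so the homology is the
   module of cycles. *)
rewrite -(mxtrace_rsim (mx_rsim_section_cap0 _ _ _)) ?inE //; last first.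
  apply/eqP; rewrite -submx0; apply: submx_trans (capmxSl _ _) _.
  rewrite genmxE submx0 -mxrank_eq0 -leqn0; apply: leq_trans (rank_leq_row _) _.
  by rewrite no3.
have im1 := hom_image_module (hom 1%N); have ker0 := hom_ker_module (hom 0%N).
have im0 := hom_image_module (hom 0%N).
rewrite -(mxtrace_ker_image (hom 1%N) (cycles_module _ _ _ 1) im1 F'G (in_setT g)).
rewrite -(mxtrace_ker_image (hom 0%N) ker0 im0 F'G (in_setT g)).
have exactness : (<<boundary 1>> :=: kermx (boundary 0))%MS.
  by apply: eqmx_trans (genmxE _) _; apply: boundary_exact.
rewrite (mxtrace_rsim ((mx_rsim_iso im1 ker0).2 (eqmx_iso _ exactness))) ?inE //.
(* The augmentation is onto; its target is spanned by the empty chain, which is fixed and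
   contributes the final 1. *)
have full0 : (<<boundary 0>> :=: 1%:M)%MS.
  have [w Xw] := word2_exists A_gt0 s1_gt0 s12 s2k.
  apply/eqmxP; rewrite submx1 genmxE; apply/row_subP=> i; rewrite row1.
  suff -> : delta_mx 0 i = word_row F s1 s2 w *m boundary 0 by rewrite submxMl.
  rewrite word_row_sum //; apply/rowP=> j; rewrite !mxE.
  suff -> : j = i by rewrite !eqxx.
  by apply: enum_val_inj; rewrite [LHS]tuple0 [RHS]tuple0.
rewrite (mxtrace_submod1 im0 full0) ?inE // mxtrace_perm_module.
have -> : #|[set t in chains 0 | tuple_action (word_action A k) 0 t g == t]| = 1%N.
  transitivity #|{: 0.-tuple T}|; last by rewrite card_tuple expn0.
  apply: eq_card => t.
  rewrite !inE (tuple0 t); apply/andP; split=> //.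
by ring.
Qed.

End TwoRankTrace.

(** * Traces on direct sums, multiples and tensor powers *)

Section MxtraceGrepr.

Variables (F : fieldType) (gT : finGroupType) (G : {group gT}) (g : gT).
Implicit Types V W : representation F G.

Lemma mxtrace_dadd_grepr V W : \tr (dadd_grepr V W g) = \tr (V g) + \tr (W g).
Proof. exact: mxtrace_block. Qed.

Lemma mxtrace_dsum_grepr (I : Type) (r : seq I) (P : pred I)
    (V : I -> representation F G) :
  \tr ((\big[dadd_grepr/grepr0]_(i <- r | P i) V i) g) =
  \sum_(i <- r | P i) \tr (V i g).
Proof.
apply: (big_morph (fun V : representation F G => \tr (V g))) => [V' W|].
  exact: mxtrace_dadd_grepr.
by rewrite mxtrace1.
Qed.

Lemma mxtrace_muln_grepr V m : \tr (muln_grepr V m g) = m%:R * \tr (V g).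
Proof. by rewrite mxtrace_dsum_grepr sumr_const card_ord mulr_natl. Qed.

Lemma mxtrace_tensor_power V v : \tr (tensor_power V v g) = \tr (V g) ^+ v.
Proof.
case: v => [|v]; first by rewrite mxtrace1.
elim: v => // v IHv; rewrite exprS -IHv; exact: mxtrace_prod.
Qed.

End MxtraceGrepr.

(** * Comparison of the two traces *)

Theorem theorem26 (R : realType) (A : finType) (n k s1 s2 : nat)
    (cardA : #|A| = n) (n_ge2 : (2 <= n)%N)
    (s1_ge1 : (1 <= s1)%N) (s1_lt_s2 : (s1 < s2)%N) (s2_le_k : (s2 <= k)%N) :
  let H := word_homology A k R[i] [in [:: s1; s2]] 1 in
  let V := specht R[i] A [:: n.-1; 1%N] in
  let c := coef_c s1 s2 in
  [/\ forall v, (1 <= v <= s2)%N -> (0 < c v)%N,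
      mx_rsim H
        (dadd_grepr
          (\big[dadd_grepr/grepr0]_(1 <= v < s1.+1)
             muln_grepr (tensor_power V v) (c v - 'C(s1, v))%N)
          (\big[dadd_grepr/grepr0]_(s1.+1 <= v < s2.+1)
             muln_grepr (tensor_power V v) (c v))),
      forall v, (1 <= v <= s1)%N -> ('C(s1, v) <= c v)%N
    & exists b : nat -> nat,
        mx_rsim H
          (\big[dadd_grepr/grepr0]_(1 <= v < s2.+1)
             muln_grepr (tensor_power V v) (b v))].
Proof.
move=> H V c.
have s12 : (0 < s1 < s2)%N by apply/andP.
have c_ge v : (1 <= v <= s1)%N -> ('C(s1, v) <= c v)%N by apply: bin_leq_coef_c.
have char0 : [pchar R[i]] =i pred0 by apply: Num.Theory.pchar_num.
have A_gt0 : (0 < #|A|)%N by rewrite cardA ltnW.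
have trV g : \tr (V g) = #|[set a | g a == a]|%:R - 1.
  by case: n n_ge2 cardA @V => [|[|m]] // _ cA; apply: mxtrace_specht_standard.
(* With x = [\tr (V g)], the (x + 1)^s2 of [sum_coef_c] cancels the fixed words of length s2, and 1
   - (x + 1)^s1 leaves the subtracted binomials. *)
have trH g : \tr (H g) = \sum_(1 <= v < s2.+1) (c v)%:R * \tr (V g) ^+ v -
               \sum_(1 <= v < s1.+1) 'C(s1, v)%:R * \tr (V g) ^+ v.
  have binS : (\tr (V g) + 1) ^+ s1 =
      1 + \sum_(1 <= v < s1.+1) 'C(s1, v)%:R * \tr (V g) ^+ v.
    pose t i := (1 ^+ (s1 - i) * \tr (V g) ^+ i) *+ 'C(s1, i).
    rewrite addrC exprDn -(big_mkord xpredT t) /t.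
    rewrite big_ltn // expr0 mulr1 expr1n bin0 mulr1n; congr (_ + _).
    by apply: eq_bigr => v _; rewrite expr1n mul1r mulr_natl.
  have s1_le : (0 < s1 <= s2)%N by rewrite s1_ge1 ltnW.
  have := sum_coef_c (\tr (V g)) s1_le; rewrite binS.
  rewrite /H mxtrace_word_homology //.
  rewrite -trV !natrX.
  have -> : #|[set a | g a == a]|%:R = \tr (V g) + 1 by rewrite trV subrK.
  rewrite binS => ->; ring.
pose b v := if (v <= s1)%N then (c v - 'C(s1, v))%N else c v.
have split_sum (f : nat -> R[i]) :
    \sum_(1 <= v < s2.+1) f v =
    \sum_(1 <= v < s1.+1) f v + \sum_(s1.+1 <= v < s2.+1) f v.
  by rewrite -big_cat_nat // ltnS ltnW.
have sum_c g : \tr (H g) =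
    \sum_(1 <= v < s1.+1) (c v - 'C(s1, v))%:R * \tr (V g) ^+ v +
    \sum_(s1.+1 <= v < s2.+1) (c v)%:R * \tr (V g) ^+ v.
  rewrite trH split_sum addrAC -sumrB; congr (_ + _).
  (* By [c_ge] the truncated subtraction in the multiplicity is a true one. *)
  rewrite !big_nat; apply: eq_bigr => v vs1.
  by rewrite natrB ?c_ge // mulrBl.
split=> //.
- by move=> v; apply: coef_c_gt0.
- apply: mx_rsim_of_mxtrace => // g _.
  rewrite sum_c mxtrace_dadd_grepr !mxtrace_dsum_grepr; congr (_ + _);
    by apply: eq_bigr => v _; rewrite mxtrace_muln_grepr mxtrace_tensor_power.
exists b; apply: mx_rsim_of_mxtrace => // g _.
rewrite sum_c mxtrace_dsum_grepr split_sum.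
congr (_ + _); rewrite !big_nat; apply: eq_bigr => v /andP[v1 v2];
  rewrite mxtrace_muln_grepr mxtrace_tensor_power /b.
  by rewrite -ltnS v2.
by rewrite leqNgt v1.
Qed.
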